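(* For every pair of integers $k \ge 2$ and $n \ge 3$, we have $\chi'_{st}(C_{2k} \,\square\, P_n) = 6$.
   Context: A star edge-coloring of a graph $G$ is a proper edge-coloring of $G$ in which there is no bichromatic path and no bichromatic cycle of length four (i.e., with four edges). The star chromatic index $\chi'_{st}(G)$ is the minimum number of colors in a star edge-coloring of $G$. $C_m$ denotes the cycle on $m$ vertices and $P_n$ the path on $n$ vertices. $G \,\square\, H$ denotes the Cartesian product: vertex set $V(G)\times V(H)$, with $(u,v)(u',v')$ an edge iff either $uu'\in E(G)$ and $v=v'$, or $u=u'$ and $vv'\in E(H)$. *)

(* Defs.v *)
From mathcomp Require Import all_boot.

Set Implicit Arguments.
Unset Strict Implicit.
Unset Printing Implicit Defensive.

Record sgraph := SGraph {
  vertex :> finType;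
  adj : rel vertex;
  adj_sym : symmetric adj;
  adj_irr : irreflexive adj
}.

Section StarEdgeColoring.
Variable G : sgraph.

Definition edges : {set {set G}} :=
  [set [set xy.1; xy.2] | xy : G * G & adj xy.1 xy.2].

Definition edge := {e : {set G} | e \in edges}.

Section Coloring.
Variables (q : nat) (c : {ffun edge -> 'I_q}).

Definition proper_edge_coloring : bool :=
  [forall e : edge, forall f : edge,
     (e != f) && (val e :&: val f != set0) ==> (c e != c f)].

(* The colors occurring on the edges of the walk x :: p. *)
Definition walk_colors (x : G) (p : seq G) : {set 'I_q} :=
  [set c e | e : edge & val e \in pairmap (fun y z => [set y; z]) x p].

Definition no_bichromatic_path4 : bool :=
  [forall x : G, forall p : 4.-tuple G,
     path (@adj G) x p && uniq (x :: p) ==> (#|walk_colors x p| != 2)].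

Definition no_bichromatic_cycle4 : bool :=
  [forall x : G, forall p : 3.-tuple G,
     cycle (@adj G) (x :: p) && uniq (x :: p) ==>
       (#|walk_colors x (rcons p x)| != 2)].

Definition star_edge_coloring : bool :=
  [&& proper_edge_coloring, no_bichromatic_path4 & no_bichromatic_cycle4].

End Coloring.

Definition star_edge_colorable (q : nat) : bool :=
  [exists c : {ffun edge -> 'I_q}, star_edge_coloring c].

Lemma mem_edges (x y : G) : adj x y -> [set x; y] \in edges.
Proof. by move=> xy; apply/imsetP; exists (x, y); rewrite ?inE. Qed.

Lemma inj_walk_colors q (c : {ffun edge -> 'I_q}) (x y z t : G) (p : seq G) :
  injective c -> uniq [:: x; y; z; t] -> path (@adj G) x [:: y, z, t & p] ->
  #|walk_colors c x [:: y, z, t & p]| != 2.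
Proof.
move=> inj_c /= /and4P[]; rewrite !inE !negb_or.
move=> /and3P[xy xz xt] /andP[yz yt] zt _ /and4P[/mem_edges e1 /mem_edges e2].
move=> /mem_edges e3 _.
pose a : edge := exist (fun e => e \in edges) _ e1.
pose b : edge := exist (fun e => e \in edges) _ e2.
pose d : edge := exist (fun e => e \in edges) _ e3.
rewrite card_imset // neq_ltn; apply/orP; right.
have neq (u v w s : G) : u != w -> u != s -> [set u; v] != [set w; s].
  move=> uw us; apply/eqP => /setP/(_ u).
  by rewrite !inE eqxx (negPf uw) (negPf us).
have ab : a != b by rewrite -(inj_eq val_inj) neq.
have ad : a != d by rewrite -(inj_eq val_inj) neq.
have bd : b != d by rewrite -(inj_eq val_inj) neq.
have uabd : uniq [:: a; b; d] by rewrite /= !inE negb_or ab ad bd.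
rewrite -[3](card_uniqP uabd); apply: subset_leq_card; apply/subsetP => e.
by rewrite !inE => /or3P[] /eqP->; rewrite eqxx ?orbT.
Qed.

Lemma star_edge_colorable_exists : exists q, star_edge_colorable q.
Proof.
exists #|{: edge}|; apply/existsP; exists [ffun e => enum_rank e].
set c := finfun _.
have inj_c : injective c by move=> e f; rewrite !ffunE; apply: enum_rank_inj.
apply/and3P; split.
- apply/forallP => e; apply/forallP => f; apply/implyP => /andP[ef _].
  by rewrite (inj_eq inj_c).
- apply/forallP => x; apply/forallP => -[[|y [|z [|t [|u []]]]] // sp].
  apply/implyP => /andP[xp up]; apply: inj_walk_colors => //.
  by move: up; rewrite [tval _]/= (cat_uniq [:: x; y; z; t] [:: u]) => /andP[].
apply/forallP => x; apply/forallP => -[[|y [|z [|t []]]] // sp].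
by apply/implyP => /andP[xp up]; apply: inj_walk_colors.
Qed.

Definition star_chromatic_index : nat := ex_minn star_edge_colorable_exists.

End StarEdgeColoring.

(* This is the cycle C_m only for m >= 3. *)
Definition cycle_adj (m : nat) : rel 'I_m :=
  fun i j => (i != j) && ((j == ordS i) || (i == ordS j)).

Lemma cycle_adj_sym m : symmetric (@cycle_adj m).
Proof. by move=> i j; rewrite /cycle_adj eq_sym orbC. Qed.

Lemma cycle_adj_irr m : irreflexive (@cycle_adj m).
Proof. by move=> i; rewrite /cycle_adj eqxx. Qed.

Definition cycle_graph (m : nat) : sgraph :=
  SGraph (@cycle_adj_sym m) (@cycle_adj_irr m).

Definition path_adj (n : nat) : rel 'I_n :=
  fun i j => (j == i.+1 :> nat) || (i == j.+1 :> nat).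

Lemma path_adj_sym n : symmetric (@path_adj n).
Proof. by move=> i j; rewrite /path_adj orbC. Qed.

Lemma path_adj_irr n : irreflexive (@path_adj n).
Proof. by move=> i; rewrite /path_adj orbb ltn_eqF. Qed.

Definition path_graph (n : nat) : sgraph :=
  SGraph (@path_adj_sym n) (@path_adj_irr n).

Definition cart_adj (G H : sgraph) : rel (G * H) :=
  fun a b => (adj a.1 b.1 && (a.2 == b.2)) || ((a.1 == b.1) && adj a.2 b.2).

Lemma cart_adj_sym G H : symmetric (@cart_adj G H).
Proof.
move=> a b; rewrite /cart_adj adj_sym [adj a.2 _]adj_sym.
by rewrite [a.1 == _]eq_sym [a.2 == _]eq_sym.
Qed.

Lemma cart_adj_irr G H : irreflexive (@cart_adj G H).
Proof. by move=> a; rewrite /cart_adj !adj_irr andbF. Qed.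

Definition cart_prod (G H : sgraph) : sgraph :=
  SGraph (@cart_adj_sym G H) (@cart_adj_irr G H).

(* Main.v *)
Require Import Defs.
From mathcomp Require Import all_boot zify.

Set Implicit Arguments.
Unset Strict Implicit.
Unset Printing Implicit Defensive.

(* Lower bound: a star edge-coloring of C_m x P_3 lifts to the infinite strip
   Z x P_3, because for m >= 4 a path with four edges in the strip projects to
   a path or to a 4-cycle. The strip contains a 3 x 3 grid with a pendant edge
   at both ends of its middle row, and an exhaustive search shows that these 14
   edges have no star edge-coloring with 5 colors.

   Upper bound: color columns with period 4 (plus two extra columns when m = 2
   mod 4) and rows with period 4; vertical edges use colors 0..3, horizontal
   edges alternate between {4, 5} and {0..3} along each row. A walk with four
   edges lies in a 5 x 5 window around its midpoint, so finitely many windows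
   are to be checked. *)

(** * Star edge-colorings as labelings of ordered pairs of vertices *)

Section StarLabeling.
Variable G : sgraph.

(** Labels on pairs avoid the subtype [edge]. The two [uniq] conditions leave [u = x] possible, so
    [star_walk4] treats four-edge paths and 4-cycles at once. *)
Record star_labeling (q : nat) (f : G -> G -> nat) : Prop := StarLabeling {
  star_ltn : forall x y, adj x y -> f x y < q;
  star_sym : forall x y, adj x y -> f x y = f y x;
  star_proper : forall x y z, adj x y -> adj y z -> x != z -> f x y != f y z;
  star_walk4 : forall x y z t u, path (@adj G) x [:: y; z; t; u] ->
    uniq [:: x; y; z; t] -> uniq [:: y; z; t; u] ->
    ~~ ((f x y == f z t) && (f y z == f t u))
}.

Lemma set2_inj (T : finType) (x y a b : T) : [set x; y] = [set a; b] ->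
  (x = a /\ y = b) \/ (x = b /\ y = a).
Proof.
move=> /setP E; have := E x; have := E y; have := E a; have := E b.
rewrite !inE !eqxx !orbT /= => /orP bE /orP aE /esym/orP yE /esym/orP xE.
by move: bE aE yE xE => -[]/eqP ? []/eqP ? []/eqP ? []/eqP ?; subst; auto.
Qed.

Lemma edge_exists (e : edge G) : exists2 xy : G * G,
  adj xy.1 xy.2 & val e = [set xy.1; xy.2].
Proof. by case: e => e /= /imsetP[xy]; rewrite inE => xy_adj ->; exists xy. Qed.

(** Two differing consecutive colors already exhaust a two-element color set, which forces the next
    two to repeat them in order. *)
Lemma card_alternating (q : nat) (a b d e : 'I_q) : a != b -> b != d -> d != e ->
  (#|[set a; b; d; e]| == 2) = (a == d) && (b == e).
Proof.
move=> ab bd de; apply/idP/andP => [/eqP card2|[/eqP<- /eqP<-]]; last first.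
  rewrite (_ : [set _; _; _; _] = [set a; b]) ?cards2 ?ab //.
  by apply/setP => i; rewrite !inE; case: (i == a); case: (i == b).
have sub : [set a; b] \subset [set a; b; d; e].
  by apply/subsetP => i; rewrite !inE => /orP[]->; rewrite ?orbT.
have /setP eqS : [set a; b] = [set a; b; d; e].
  by apply/eqP; rewrite eqEcard sub card2 cards2 ab.
have /eqP da : d == a.
  by have := eqS d; rewrite !inE eqxx [d == b]eq_sym (negPf bd) !(orbT, orbF).
split; first by rewrite da.
have := eqS e; rewrite !inE eqxx !orbT -da [e == d]eq_sym (negPf de) /=.
by rewrite eq_sym.
Qed.

Section Labeling.
Variables (q : nat) (c : {ffun edge G -> 'I_q}) (f : G -> G -> nat).
Hypothesis fc : forall (e : edge G) x y, val e = [set x; y] -> c e = f x y :> nat.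

Lemma walk_colorsE x p i : path (@adj G) x p ->
  (i \in walk_colors c x p) = (val i \in pairmap f x p).
Proof.
move=> xp; apply/imsetP/idP => [[e]|].
  rewrite inE => e_in ->; elim: p x {xp} e_in => //= y p IHp x.
  by rewrite !inE => /orP[/eqP/fc->|/IHp->]; rewrite ?eqxx ?orbT.
elim: p x xp => //= y p IHp x /andP[xy yp]; rewrite inE => /orP[/eqP ixy|].
  pose e : edge G := exist (fun e => e \in edges G) _ (mem_edges xy).
  exists e; first by rewrite !inE eqxx.
  by apply: val_inj; rewrite /= (@fc e x y).
by move=> /(IHp _ yp)[e]; rewrite inE => e_in ->; exists e; rewrite // !inE e_in orbT.
Qed.

Hypothesis f_proper :
  forall x y z, adj x y -> adj y z -> x != z -> f x y != f y z.

Lemma card_walk_colors x y z t u : path (@adj G) x [:: y; z; t; u] ->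
  x != z -> y != t -> z != u ->
  (#|walk_colors c x [:: y; z; t; u]| == 2) = (f x y == f z t) && (f y z == f t u).
Proof.
move=> p4 xz yt zu; have := p4 => /and5P[xy yz zt tu _].
have ex v w : adj v w -> exists2 i : 'I_q, i = f v w :> nat & True.
  move=> /mem_edges vw; pose e : edge G := exist (fun e => e \in edges G) _ vw.
  by exists (c e) => //; apply: fc.
have [a ea _] := ex _ _ xy; have [b eb _] := ex _ _ yz.
have [d ed _] := ex _ _ zt; have [e ee _] := ex _ _ tu.
rewrite -ea -eb -ed -ee !val_eqE -card_alternating -?val_eqE /= ?ea ?eb ?ed ?ee ?f_proper //.
congr (_ == 2); apply: eq_card => i.
by rewrite walk_colorsE //= !inE -ea -eb -ed -ee !val_eqE !orbA.
Qed.

End Labeling.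

Lemma star_edge_colorableP q :
  star_edge_colorable G q <-> exists f, star_labeling q f.
Proof.
split=> [/existsP[c /and3P[properc path4 cycle4]]|[f [f_lt f_sym f_proper f_walk]]].
  (* The value 0 off the edges is a dummy: every field of [star_labeling] assumes adjacency. *)
  pose f (x y : G) : nat :=
    if insub [set x; y] is Some e then c e : nat else 0.
  have fc (e : edge G) x y : val e = [set x; y] -> c e = f x y :> nat.
    by move=> exy; rewrite /f -exy valK.
  have f_edge x y : adj x y -> exists2 e : edge G, val e = [set x; y] & f x y = c e.
    move=> /mem_edges xy; pose e : edge G := exist (fun e => e \in edges G) _ xy.
    by exists e => //; rewrite (fc e x y).
  have f_proper x y z : adj x y -> adj y z -> x != z -> f x y != f y z.
    move=> xy yz xz; have [e1 e1E ->] := f_edge _ _ xy.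
    have [e2 e2E ->] := f_edge _ _ yz; rewrite val_eqE.
    move: properc => /forallP/(_ e1)/forallP/(_ e2)/implyP; apply.
    apply/andP; split; last by apply/set0Pn; exists y; rewrite e1E e2E !inE !eqxx orbT.
    apply: contra xz => /eqP e12; have := congr1 val e12; rewrite e1E e2E.
    by move=> /set2_inj[[-> <-]|[-> _]].
  exists f; split=> //.
  - by move=> x y /f_edge[e _ ->].
  - by move=> x y _; rewrite /f setUC.
  move=> x y z t u p4 u4 u4'.
  have [xz yt zu] : [/\ x != z, y != t & z != u].
    by move: u4 u4'; rewrite /= !inE !negb_or => /and3P[/and3P[_ -> _] /andP[_ ->] _]
      /and3P[_ /andP[_ ->] _].
  rewrite -(card_walk_colors fc f_proper p4 xz yt zu).
  (* A closed walk is a 4-cycle; otherwise the five vertices are distinct. *)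
  have [ux|xu] := eqVneq u x.
    move: cycle4 => /forallP/(_ x)/forallP/(_ [tuple y; z; t])/implyP.
    rewrite ux in p4 *; apply.
    by rewrite /cycle /= in p4 u4 *; rewrite p4.
  move: path4 => /forallP/(_ x)/forallP/(_ [tuple y; z; t; u])/implyP; apply.
  apply/andP; split=> //; move: u4 u4'; rewrite /= !inE !negb_or [x == u]eq_sym xu.
  by rewrite !andbT => /and3P[/and3P[-> -> ->] _ _].
(* By symmetry of [f], the color of an edge does not depend on the order of its ends. *)
have [c cP] : exists c : edge G -> 'I_q, forall e,
    forall x y, val e = [set x; y] -> c e = f x y :> nat.
  apply: (@fin_all_exists _ (fun _ => 'I_q) (fun e i =>
    forall x y, val e = [set x; y] -> i = f x y :> nat)) => e.
  have [[x y] /= xy ->] := edge_exists e.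
  exists (Ordinal (f_lt _ _ xy)) => a b /set2_inj[[<- <-]|[<- <-]] //=.
  exact: f_sym.
pose c' := [ffun e => c e].
have fc (e : edge G) x y : val e = [set x; y] -> c' e = f x y :> nat.
  by rewrite ffunE; apply: cP.
apply/existsP; exists c'; apply/and3P; split.
- apply/forallP => e1; apply/forallP => e2; apply/implyP => /andP[e12 /set0Pn[y]].
  have [[a b] /= ab e1E] := edge_exists e1; have [[a' b'] /= ab' e2E] := edge_exists e2.
  have other (v w z : G) (e : edge G) : adj v w -> val e = [set v; w] ->
      z \in val e -> exists2 s, adj s z & val e = [set s; z].
    move=> vw ->; rewrite !inE => /orP[]/eqP->; last by exists v.
    by exists w; rewrite 1?adj_sym // setUC.
  rewrite inE => /andP[/(other _ _ _ _ ab e1E)[x xy e1xy]].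
  move=> /(other _ _ _ _ ab' e2E)[z zy e2zy].
  rewrite -val_eqE /= (fc _ _ _ e1xy) (fc e2 y z) 1?setUC //.
  apply: f_proper => //; first by rewrite adj_sym.
  apply: contra e12 => /eqP xz.
  by apply/eqP/val_inj; rewrite e1xy e2zy xz.
- apply/forallP => x; apply/forallP => -[[|y [|z [|t [|u []]]]] // sp].
  apply/implyP => /andP[p4 u5]; have := u5; rewrite /= !inE !negb_or.
  move=> /and5P[/and4P[xy xz xt xu] /and3P[yz yt yu] /andP[zt zu] tu _].
  rewrite (card_walk_colors fc) //; apply: f_walk => //=;
  by rewrite !inE !negb_or ?xy ?xz ?xt ?yz ?yt ?yu ?zt ?zu ?tu.
apply/forallP => x; apply/forallP => -[[|y [|z [|t []]]] // sp].
apply/implyP => /andP[p4 u4]; have := u4; rewrite /= !inE !negb_or.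
move=> /and4P[/and3P[xy xz xt] /andP[yz yt] zt _].
have zx : z != x by rewrite eq_sym.
rewrite /= (card_walk_colors fc f_proper p4 xz yt zx); apply: f_walk => //=.
by rewrite !inE !negb_or yz yt zt [y == x]eq_sym xy zx [t == x]eq_sym xt.
Qed.

Lemma star_edge_colorable_leq q r :
  q <= r -> star_edge_colorable G q -> star_edge_colorable G r.
Proof.
move=> qr /star_edge_colorableP[f [f_lt ? ? ?]]; apply/star_edge_colorableP.
by exists f; split=> // x y /f_lt/leq_trans; apply.
Qed.

Lemma star_chromatic_index_eq q : star_edge_colorable G q.+1 ->
  ~~ star_edge_colorable G q -> star_chromatic_index G = q.+1.
Proof.
move=> colS ncol; rewrite /star_chromatic_index; case: ex_minnP => m colm min_m.
apply/eqP; rewrite eqn_leq min_m //= ltnNge; apply: contra ncol => mq.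
exact: star_edge_colorable_leq mq colm.
Qed.

End StarLabeling.

(** * Enumeration of walks and backtracking search *)

Fixpoint walks (T : eqType) (pts : seq T) (e : rel T) (l : nat) : seq (seq T) :=
  if l is l'.+1 then
    [seq x :: w | w <- walks pts e l', x <- [seq x <- pts | path e x w]]
  else [:: [::]].

Lemma mem_walks (T : eqType) (pts : seq T) (e : rel T) l w :
  (w \in walks pts e l) = [&& size w == l, all [in pts] w & sorted e w].
Proof.
elim: l w => [|l IHl] [|x w] //=.
  by apply/allpairsPdep => -[v [y []]].
apply/allpairsPdep/and3P => [[v [y [v_in y_in [-> ->]]]]|[sw /andP[x_in w_in] xw]].
  move: v_in y_in; rewrite IHl mem_filter => /and3P[/eqP-> -> _] /andP[-> ->].
  by rewrite eqxx.
exists w, x; rewrite IHl mem_filter xw x_in -eqSS sw w_in; split=> //.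
exact: path_sorted xw.
Qed.

Section Backtracking.
Variable q : nat.

(* The constraint (a, b, c, d) forbids s_a = s_b and s_c = s_d simultaneously;
   (a, b, a, a) thus encodes s_a <> s_b. *)
Definition constraint := (nat * nat * nat * nat)%type.

Definition violated (s : nat -> nat) (k : constraint) : bool :=
  let: (a, b, c, d) := k in (s a == s b) && (s c == s d).

Definition last_index (k : constraint) : nat :=
  let: (a, b, c, d) := k in maxn (maxn a b) (maxn c d).

(* Level i lists the constraints that become decidable once s_i is known. *)
Definition levels (ks : seq constraint) (m l : nat) : seq (seq constraint) :=
  [seq [seq k <- ks | last_index k == i] | i <- iota m l].

(* The conditional, unlike ||, does not evaluate both branches by value. *)
Fixpoint refute (lv : seq (seq constraint)) (s : seq nat) : bool :=
  if lv is ks :: lv' then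
    all (fun x => let s' := rcons s x in
      if has (violated (nth 0 s')) ks then true else refute lv' s') (iota 0 q)
  else false.

(** Follow the branch that gives each index [i] the value [g i]. Constraints of level [m] involve
    indices up to [m] only, so the prefix violates them exactly when [g] does; as the branch is
    refuted, this happens at some level. *)
Lemma refuteP ks l (g : nat -> nat) m : (forall i, i < m + l -> g i < q) ->
  refute (levels ks m l) (mkseq g m) -> has (violated g) ks.
Proof.
elim: l m => // l IHl m g_lt /= /allP/(_ (g m)).
rewrite mem_iota add0n g_lt ?addnS ?ltnS ?leq_addr // => /(_ isT).
rewrite -mkseqS; case: ifP => [/hasP[k]|_]; last by apply: IHl; rewrite addSnnS.
rewrite mem_filter => /andP[/eqP km k_in] k_viol _; apply/hasP; exists k => //.
case: k km k_viol {k_in} => [[[a b] c] d] /= km.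
by rewrite !nth_mkseq //; lia.
Qed.

End Backtracking.

(** * Five colors do not suffice *)

Definition gridpt := (nat * nat)%type.

(* The 3 x 3 grid in columns 1, 2, 3, with a pendant edge at both ends of its
   middle row. The four edges at (1, 1) come first. *)
Definition grid_edges : seq (gridpt * gridpt) :=
  [:: ((0, 1), (1, 1)); ((1, 0), (1, 1)); ((1, 1), (1, 2)); ((1, 1), (2, 1));
      ((2, 0), (2, 1)); ((1, 0), (2, 0)); ((2, 0), (3, 0)); ((2, 1), (3, 1));
      ((3, 0), (3, 1)); ((3, 1), (3, 2)); ((3, 1), (4, 1)); ((2, 1), (2, 2));
      ((1, 2), (2, 2)); ((2, 2), (3, 2))].

Definition grid_points : seq gridpt :=
  [seq (i, j) | i <- iota 0 5, j <- iota 0 3].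

(** Both orientations share an index, and a pair that is not an edge gets 14, the length of the
    list. *)
Definition edge_index (x y : gridpt) : nat :=
  find (fun e => (e == (x, y)) || (e == (y, x))) grid_edges.

Definition grid_adj (x y : gridpt) : bool := edge_index x y < 14.

(* Points whose columns are less than 4 apart stay distinct in C_m, m >= 4. *)
Definition grid_neq (x y : gridpt) : bool :=
  [&& x != y, x.1 < y.1 + 4, y.1 < x.1 + 4, x.2 < 3 & y.2 < 3].

Definition walk_constraints (w : seq gridpt) : seq constraint :=
  match w with
  | [:: x; y; z] =>
    if grid_neq x z then
      let a := edge_index x y in [:: (a, edge_index y z, a, a)]
    else [::]
  | [:: x; y; z; t; u] =>
    if pairwise grid_neq [:: x; y; z; t] && pairwise grid_neq [:: y; z; t; u] then
      [:: (edge_index x y, edge_index z t, edge_index y z, edge_index t u)]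
    else [::]
  | _ => [::]
  end.

Definition grid_constraints : seq constraint :=
  flatten [seq walk_constraints w |
    w <- walks grid_points grid_adj 3 ++ walks grid_points grid_adj 5].

(** The edges at (1, 1) meet pairwise, so up to renaming they have colors 0, 1, 2, 3. The search
    starts from there and runs over the other ten edges. *)
Lemma grid_not_5_colorable : refute 5 (levels grid_constraints 4 10) (iota 0 4).
Proof. by vm_compute. Qed.

Lemma edge_index_nth x y : grid_adj x y ->
  let e := nth ((0, 0), (0, 0)) grid_edges (edge_index x y) in e = (x, y) \/ e = (y, x).
Proof.
rewrite /grid_adj /edge_index => xy.
have := @nth_find _ ((0, 0), (0, 0)) (fun e => (e == (x, y)) || (e == (y, x))) grid_edges.
by rewrite has_find => /(_ xy)/orP[]/eqP; [left|right].
Qed.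

Section LowerBound.
Variables m n : nat.
Let G := cart_prod (cycle_graph m.+4) (path_graph n.+3).

(** For [m = 0] columns 0 and 4 coincide, and the two pendant ends become one vertex. *)
Definition grid_vertex (x : gridpt) : G := (inord (x.1 %% m.+4), inord x.2).

Lemma grid_vertex_neq x y : grid_neq x y -> grid_vertex x != grid_vertex y.
Proof.
case: x y => [i j] [i' j'] /and5P[/= /eqP xy ii' i'i j3 j'3].
apply/eqP => -[/(congr1 (@nat_of_ord _)) + /(congr1 (@nat_of_ord _))].
rewrite !inordK ?ltn_pmod //; try lia.
move=> eqi eqj; apply: xy; rewrite eqj; congr (_, _).
wlog le_ii : i i' ii' i'i eqi / i <= i'.
  by move=> wl; case/orP: (leq_total i i') => ?; [|symmetry]; apply: wl.
move/eqP: eqi; rewrite eq_sym eqn_mod_dvd // => /dvdn_leq; lia.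
Qed.

Lemma grid_edge_adj e : e \in grid_edges -> adj (grid_vertex e.1) (grid_vertex e.2).
Proof.
have step i j : adj (grid_vertex (i, j)) (grid_vertex (i.+1, j)).
  rewrite /= /cart_adj /= eqxx andbT /cycle_adj; apply/orP; left.
  apply/andP; split; last first.
    by rewrite -!val_eqE /= !inordK ?ltn_pmod // -[(i %% _).+1]addn1 modnDml addn1 eqxx.
  rewrite -val_eqE /= !inordK ?ltn_pmod // eq_sym eqn_mod_dvd ?leqnSn //.
  by rewrite subSnn.
have up i j : j < 2 -> adj (grid_vertex (i, j)) (grid_vertex (i, j.+1)).
  move=> j2; rewrite /= /cart_adj /= eqxx /path_adj !inordK ?eqxx ?orbT //; lia.
pose unit_step (e : gridpt * gridpt) :=
  (e.2 == (e.1.1.+1, e.1.2)) || (e.2 == (e.1.1, e.1.2.+1)) && (e.1.2 < 2).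
have /allP steps : all unit_step grid_edges by [].
move=> /steps; case: e => [[i j] b] /orP[/eqP/= ->|/andP[/eqP/= -> j2]].
  exact: step.
exact: up.
Qed.

Theorem cycle_path_not_5_colorable : ~~ star_edge_colorable G 5.
Proof.
apply/negP => /star_edge_colorableP[f [f_lt f_sym f_proper f_walk]].
pose lab (e : gridpt * gridpt) := f (grid_vertex e.1) (grid_vertex e.2).
pose cs := map lab (take 4 grid_edges).
(* Sending a color to its index in s renames the four colors at (1, 1) to 0, 1, 2, 3. *)
pose s := cs ++ [seq i <- iota 0 5 | i \notin cs].
pose g i := index (lab (nth ((0, 0), (0, 0)) grid_edges i)) s.
have mem_s i : (i \in s) = (i < 5) || (i \in cs).
  by rewrite mem_cat mem_filter mem_iota add0n leq0n; case: (i \in cs); rewrite ?orbT ?orbF.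
have adj_of x y : grid_adj x y -> adj (grid_vertex x) (grid_vertex y).
  move=> xy; have := mem_nth ((0, 0), (0, 0)) (xy : edge_index x y < size grid_edges).
  move=> /grid_edge_adj; case: (edge_index_nth xy) => -> // yx.
  by rewrite adj_sym.
have gE x y : grid_adj x y -> g (edge_index x y) = index (f (grid_vertex x) (grid_vertex y)) s.
  move=> xy; rewrite /g /lab; case: (edge_index_nth xy) => -> //=.
  by rewrite -f_sym // adj_of.
have g_eq x y z t : grid_adj x y -> grid_adj z t ->
    (g (edge_index x y) == g (edge_index z t))
    = (f (grid_vertex x) (grid_vertex y) == f (grid_vertex z) (grid_vertex t)).
  move=> xy zt; rewrite !gE //; apply/eqP/eqP => [|->] //.
  by apply: (@index_inj _ 0 s); rewrite ?mem_s f_lt ?adj_of.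
(* [proper] wants edges head to tail, so [sym] reverses some of the four edges at (1, 1). *)
have uniq_cs : uniq cs.
  have proper x y z : grid_adj x y -> grid_adj y z -> grid_neq x z ->
      lab (x, y) == lab (y, z) = false.
    by move=> xy yz xz; apply/negbTE/f_proper; rewrite ?adj_of ?grid_vertex_neq.
  have sym x y : grid_adj x y -> lab (x, y) = lab (y, x).
    by move=> xy; rewrite /lab f_sym ?adj_of.
  rewrite /cs /= !inE [lab ((1, 0), _)]sym // !negb_or.
  rewrite !proper // -sym // !proper //.
  by rewrite [lab ((1, 1), (1, 2))]sym // proper.
have size_s : size s = 5.
  have uniq_s : uniq s.
    rewrite cat_uniq uniq_cs filter_uniq ?iota_uniq // andbT.
    by apply/hasPn => i; rewrite mem_filter => /andP[].
  (* All labels in [cs] are below 5, so [s] is a reordering of the five colors. *)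
  suff : perm_eq s (iota 0 5) by move=> /perm_size.
  apply: uniq_perm => // i.
  rewrite mem_s mem_iota add0n; case: ltnP => //= i5; apply/negbTE/mapP => -[e].
  by move=> /mem_take/grid_edge_adj/f_lt + iE; rewrite -/(lab e) -iE ltnNge i5.
have g_lt i : i < 4 + 10 -> g i < 5.
  move=> i14; rewrite -size_s index_mem mem_s f_lt //.
  exact/grid_edge_adj/mem_nth.
have g4 : mkseq g 4 = iota 0 4.
  apply: (@eq_from_nth _ 0) => // i; rewrite size_mkseq => i4.
  rewrite nth_mkseq // nth_iota // /g.
  have -> : lab (nth ((0, 0), (0, 0)) grid_edges i) = nth 0 cs i.
    by rewrite (nth_map ((0, 0), (0, 0))) ?nth_take.
  by rewrite index_cat mem_nth // index_uniq.
(* The violated constraint comes from a grid walk whose image contradicts [f_proper] or [f_walk]. *)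
have := grid_not_5_colorable; rewrite -g4 => /(refuteP g_lt)/hasP[k].
move=> /flattenP[_ /mapP[w w_in ->]].
have : sorted grid_adj w by move: w_in; rewrite mem_cat !mem_walks => /orP[]/and3P[].
case: w {w_in} => [|x [|y [|z [|t [|u [|? ?]]]]]] //=; case: ifP => //.
  move=> xz /and3P[xy yz _]; rewrite inE => /eqP-> /=.
  by rewrite g_eq // eqxx andbT; apply/negP/f_proper; rewrite ?adj_of ?grid_vertex_neq.
move=> /andP[u4 u4'] /and5P[xy yz zt tu _]; rewrite inE => /eqP-> /=.
have uniq_of v : pairwise grid_neq v -> uniq (map grid_vertex v).
  move=> v_pw; rewrite uniq_pairwise pairwise_map; apply: sub_pairwise v_pw => a b /=.
  exact: grid_vertex_neq.
rewrite !g_eq //; apply/negP/f_walk; first by apply/and5P; split=> //; apply: adj_of.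
  exact: (uniq_of [:: x; y; z; t]).
exact: (uniq_of [:: y; z; t; u]).
Qed.

End LowerBound.

(** * A periodic coloring with six colors, checked on windows *)

(* Columns are colored with period 4, except that a cycle of length 2 mod 4
   ends with two extra columns of types 4 and 5. *)
Definition col_type (L i : nat) : nat :=
  if (L %% 4 == 2) && (L <= i + 2) then 4 + i %% 4 else i %% 4.

Definition next_type (a b : nat) : bool :=
  (b == a.+1) || (b == 0) && (a \in [:: 3; 5]).

(** If 4 divides the length, the types wrap from 3 to 0. Otherwise the last two columns have
    residues 0 and 1, and the types end with 3, 4, 5 before returning to 0. *)
Lemma next_col_type m (i : 'I_m.+4) : ~~ odd m ->
  next_type (col_type m.+4 i) (col_type m.+4 (ordS i)).
Proof.
move=> m_even; rewrite /next_type /col_type /= !inE.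
have := ltn_ord i; rewrite leq_eqVlt => /orP[/eqP iL|iL].
  by rewrite iL modnn; do 2?case: ifP => ?; lia.
by rewrite [i.+1 %% m.+4]modn_small //; do 2?case: ifP => ?; lia.
Qed.

Lemma col_type_lt L i : ~~ odd L -> i < L -> col_type L i < 6.
Proof. by move=> L_even iL; rewrite /col_type; case: ifP => ?; lia. Qed.

Definition vcolor (t r : nat) : nat := (r + t) %% 4.

(** For odd [t] this is the one residue modulo 4 missing from the vertical edges at both ends: these
    use [r + t - 1], [r + t], [r + t + 1], except that after type 5 comes type 0, which gives [r],
    [r + 1], [r + 3]. *)
Definition hcolor (t r : nat) : nat :=
  if odd t then (if t == 5 then r + 2 else r + 3 * t) %% 4 else 4 + odd (r + t./2).

Lemma vcolor_lt t r : vcolor t r < 6.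
Proof. by rewrite /vcolor; lia. Qed.

Lemma hcolor_lt t r : hcolor t r < 6.
Proof. by rewrite /hcolor; do 2?case: ifP => _; lia. Qed.

Lemma vcolor_mod t r r' : r = r' %[mod 4] -> vcolor t r = vcolor t r'.
Proof. by rewrite /vcolor => rr'; rewrite -modnDml rr' modnDml. Qed.

Lemma hcolor_mod t r r' : r = r' %[mod 4] -> hcolor t r = hcolor t r'.
Proof.
rewrite /hcolor => rr'; case: ifP => _; first by case: ifP => _; rewrite -modnDml rr' modnDml.
by rewrite !oddD -(@odd_mod r 4) // rr' odd_mod.
Qed.

(* A direction is (horizontal, forward). *)
Definition direction := (bool * bool)%type.
Definition directions : seq direction :=
  [:: (true, true); (true, false); (false, true); (false, false)].
Definition opposite (d : direction) : direction := (d.1, ~~ d.2).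

Lemma mem_directions d : d \in directions. Proof. by case: d => [[] []]. Qed.

Definition move_to (d : direction) (p : nat * nat) : nat * nat :=
  match d with
  | (true, true) => (p.1.+1, p.2)
  | (true, false) => (p.1.-1, p.2)
  | (false, true) => (p.1, p.2.+1)
  | (false, false) => (p.1, p.2.-1)
  end.

(* The color of the edge leaving p in direction d, when w lists the types of the
   columns and row 0 of the window is row r modulo 4. *)
Definition edge_color (w : seq nat) (r : nat) (p : nat * nat) (d : direction) : nat :=
  match d with
  | (true, true) => hcolor (nth 0 w p.1) (r + p.2)
  | (true, false) => hcolor (nth 0 w p.1.-1) (r + p.2)
  | (false, true) => vcolor (nth 0 w p.1) (r + p.2)
  | (false, false) => vcolor (nth 0 w p.1) (r + p.2.-1)
  end.

Lemma edge_color_mod w r r' p d :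
  r = r' %[mod 4] -> edge_color w r p d = edge_color w r' p d.
Proof.
move=> rr'; have mod_add s : r + s = r' + s %[mod 4] by rewrite -modnDml rr' modnDml.
by case: d => [[] []] /=; (apply: hcolor_mod || apply: vcolor_mod).
Qed.

(* Every walk of length 4 lies in the 5 x 5 window around its midpoint (2, 2). *)
Definition window_proper (w : seq nat) (r : nat) (d1 d2 : direction) : bool :=
  (d1 == d2) || (edge_color w r (2, 2) d1 != edge_color w r (2, 2) d2).

Definition window_walk4 (w : seq nat) (r : nat) (d1 d2 d3 d4 : direction) : bool :=
  [|| d1 == d2, d3 == opposite d1, d4 == opposite d2 |
   ~~ ((edge_color w r (move_to d1 (2, 2)) d3 == edge_color w r (2, 2) d2) &&
       (edge_color w r (2, 2) d1 == edge_color w r (move_to d2 (2, 2)) d4))].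

Definition window_ok (w : seq nat) (r : nat) : bool :=
  all (fun d1 => all (fun d2 => window_proper w r d1 d2 &&
    all (fun d3 => all (fun d4 => window_walk4 w r d1 d2 d3 d4)
      directions) directions) directions) directions.

(** The check ignores the boundary rows of the path: there some directions are missing, which only
    removes conditions. *)
Lemma windows_ok :
  all (fun w => all (window_ok w) (iota 0 4)) (walks (iota 0 6) next_type 5).
Proof. by vm_compute. Qed.

(** * Transfer from windows to the product graph *)

Section UpperBound.
Variables m n : nat.
Hypothesis m_even : ~~ odd m.
Let L := m.+4.
Let G := cart_prod (cycle_graph L) (path_graph n).

Definition coltype (i : 'I_L) : nat := col_type L i.

Definition grid_color (x y : G) : nat :=
  if x.1 == y.1 then vcolor (coltype x.1) (minn x.2 y.2)
  else if y.1 == ordS x.1 then hcolor (coltype x.1) x.2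
  else hcolor (coltype y.1) x.2.

Definition is_step (d : direction) (x y : G) : Prop :=
  match d with
  | (true, true) => y.1 = ordS x.1 /\ y.2 = x.2
  | (true, false) => x.1 = ordS y.1 /\ y.2 = x.2
  | (false, true) => y.1 = x.1 /\ y.2 = x.2.+1 :> nat
  | (false, false) => y.1 = x.1 /\ x.2 = y.2.+1 :> nat
  end.

Lemma ordS_neq (i : 'I_L) : ordS i != i.
Proof.
rewrite -val_eqE /=; have := ltn_ord i; rewrite leq_eqVlt => /orP[/eqP iL|iL].
  by rewrite iL modnn; lia.
by rewrite modn_small //; lia.
Qed.

(** This makes the forward orientation of a horizontal edge unambiguous, so [grid_color] is
    symmetric on edges. *)
Lemma ordS2_neq (i : 'I_L) : ordS (ordS i) != i.
Proof.
rewrite -val_eqE /=; have := ltn_ord i; rewrite leq_eqVlt => /orP[/eqP iL|iL].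
  by rewrite iL modnn modn_small //; lia.
rewrite [i.+1 %% _]modn_small //; move: iL; rewrite leq_eqVlt => /orP[/eqP iL|iL].
  by rewrite iL modnn; lia.
by rewrite modn_small //; lia.
Qed.

Lemma adj_step (x y : G) : adj x y -> exists d, is_step d x y.
Proof.
rewrite /= /cart_adj /= /cycle_adj /path_adj.
move=> /orP[/andP[/andP[_ /orP[]/eqP xy] /eqP e]|/andP[/eqP e /orP[]/eqP xy]].
- by exists (true, true).
- by exists (true, false).
- by exists (false, true).
- by exists (false, false).
Qed.

Lemma step_fun d x y y' : is_step d x y -> is_step d x y' -> y = y'.
Proof.
case: x y y' => [i r] [j s] [j' s']; case: d => [[] []] /= [e1 e2] [e1' e2'].
- by rewrite e1 e2 e1' e2'.
- by rewrite e2 e2' (@ordS_inj L j j') -?e1.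
- by rewrite e1 e1'; congr (_, _); apply: val_inj; rewrite /= e2 e2'.
- by rewrite e1 e1'; congr (_, _); apply: val_inj; apply: succn_inj; rewrite -e2 -e2'.
Qed.

Lemma step_opposite d x y : is_step d x y -> is_step (opposite d) y x.
Proof. by case: d => [[] []] /= [-> ->]. Qed.

Lemma grid_color_sym x y : adj x y -> grid_color x y = grid_color y x.
Proof.
move=> /adj_step[d]; rewrite /grid_color; case: d => [[] []] /= [].
- by move=> -> ->; rewrite [_ == ordS x.1]eq_sym !(negPf (ordS_neq _)) eqxx
    [_ == ordS (ordS _)]eq_sym (negPf (ordS2_neq _)).
- by move=> -> ->; rewrite [_ == ordS y.1]eq_sym !(negPf (ordS_neq _)) eqxx
    [_ == ordS (ordS _)]eq_sym (negPf (ordS2_neq _)).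
- by move=> -> _; rewrite eqxx minnC.
- by move=> -> _; rewrite eqxx minnC.
Qed.

Section Window.
Variable z : G.

Definition window_col (j : nat) : 'I_L := iter j (@ordS L) (ord_pred (ord_pred z.1)).

Definition window_types : seq nat := [seq coltype (window_col j) | j <- iota 0 5].

(** Row 2 of the window is the row of [z], so row 0 is [z.2 - 2], congruent to [z.2 + 2] modulo
    4. *)
Lemma window_types_ok d1 d2 d3 d4 :
  window_proper window_types (z.2 + 2) d1 d2 /\
  window_walk4 window_types (z.2 + 2) d1 d2 d3 d4.
Proof.
have types_in : window_types \in walks (iota 0 6) next_type 5.
  rewrite mem_walks size_map size_iota; apply/and3P; split=> //.
    apply/allP => _ /mapP[j _ ->]; change (coltype (window_col j) \in iota 0 6).
    by rewrite mem_iota col_type_lt //= !negbK.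
  by rewrite /= /coltype !next_col_type.
have r_in : (z.2 + 2) %% 4 \in iota 0 4 by rewrite mem_iota ltn_pmod.
have := windows_ok => /allP/(_ _ types_in)/allP/(_ _ r_in).
move=> /allP/(_ d1 (mem_directions _))/allP/(_ d2 (mem_directions _))/andP[].
move=> + /allP/(_ d3 (mem_directions _))/allP/(_ d4 (mem_directions _)).
rewrite /window_proper /window_walk4.
by rewrite !(@edge_color_mod _ ((z.2 + 2) %% 4) (z.2 + 2)) ?modn_mod.
Qed.

(** Adding 2 on the left avoids truncated subtraction when [z] is near row 0. *)
Definition located (p : nat * nat) (y : G) : Prop :=
  y.1 = window_col p.1 /\ y.2 + 2 = z.2 + p.2.

Lemma located_center : located (2, 2) z.
Proof. by split=> //=; rewrite !ord_predK. Qed.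

Lemma located_step p d x y : 0 < p.1 < 4 -> 0 < p.2 -> located p x -> is_step d x y ->
  grid_color x y = edge_color window_types (z.2 + 2) p d /\ located (move_to d p) y.
Proof.
case: p => [j s] /= /andP[j0 j4] s0 [/= xj xs].
have nth_types i : i < 5 -> nth 0 window_types i = coltype (window_col i).
  by move=> i5; rewrite (nth_map 0) ?size_iota // nth_iota.
have rE : z.2 + 2 + s = x.2 %[mod 4].
  by rewrite -addnA [2 + s]addnC addnA -xs -addnA modnDr.
rewrite /grid_color; case: d => [[] []] /= [e1 e2].
- rewrite e1 e2 [_ == ordS _]eq_sym (negPf (ordS_neq _)) eqxx nth_types ?xj; last by lia.
  by rewrite (hcolor_mod _ rE); split=> //; split; rewrite /= ?e1 ?e2 ?xj.
- have yj : y.1 = window_col j.-1 by apply: (@ordS_inj L); rewrite -e1 xj -{1}(prednK j0).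
  rewrite e1 e2 (negPf (ordS_neq _)) [_ == ordS _]eq_sym (negPf (ordS2_neq _)).
  by rewrite nth_types ?yj ?(hcolor_mod _ rE) //; [split=> //; split; rewrite /= ?e2 | lia].
- rewrite e1 eqxx nth_types ?xj; last by lia.
  rewrite (vcolor_mod _ rE) (minn_idPl _) ?e2 //; split=> //; split; rewrite /= ?e1 //; lia.
- rewrite e1 eqxx nth_types ?xj; last by lia.
  have -> : minn x.2 y.2 = y.2 by apply/minn_idPr; rewrite e2.
  split; last by split; rewrite /= ?e1 //; lia.
  have rE' : z.2 + 2 + s.-1 = y.2 + 4 by rewrite /= in xs e2 *; lia.
  by apply: vcolor_mod; rewrite rE' modnDr.
Qed.

Lemma grid_color_center x y : adj z x -> adj z y -> x != y ->
  grid_color z x != grid_color z y.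
Proof.
move=> /adj_step[d1 s1] /adj_step[d2 s2] xy.
have [-> _] := @located_step (2, 2) _ _ _ isT isT located_center s1.
have [-> _] := @located_step (2, 2) _ _ _ isT isT located_center s2.
have [/orP[/eqP d12|] //] := window_types_ok d1 d2 d1 d1.
by case/eqP: xy; apply: step_fun s1 _; rewrite d12.
Qed.

Lemma grid_color_walk4 x y t u : adj z y -> adj y x -> adj z t -> adj t u ->
  y != t -> x != z -> u != z ->
  ~~ ((grid_color y x == grid_color z t) && (grid_color z y == grid_color t u)).
Proof.
move=> /adj_step[d1 s1] /adj_step[d3 s3] /adj_step[d2 s2] /adj_step[d4 s4] yt xz uz.
have [-> ly] := @located_step (2, 2) _ _ _ isT isT located_center s1.
have [-> lt] := @located_step (2, 2) _ _ _ isT isT located_center s2.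
have [j1 r1] : 0 < (move_to d1 (2, 2)).1 < 4 /\ 0 < (move_to d1 (2, 2)).2.
  by case: (d1) => [[] []].
have [j2 r2] : 0 < (move_to d2 (2, 2)).1 < 4 /\ 0 < (move_to d2 (2, 2)).2.
  by case: (d2) => [[] []].
have [-> _] := located_step j1 r1 ly s3; have [-> _] := located_step j2 r2 lt s4.
have [_ /or4P[/eqP d12|/eqP d31|/eqP d42|//]] := window_types_ok d1 d2 d3 d4.
- by case/eqP: yt; apply: step_fun s1 _; rewrite d12.
- by case/eqP: xz; apply: step_fun s3 _; rewrite d31; apply: step_opposite.
- by case/eqP: uz; apply: step_fun s4 _; rewrite d42; apply: step_opposite.
Qed.

End Window.

Theorem cycle_path_6_colorable : star_edge_colorable G 6.
Proof.
apply/star_edge_colorableP; exists grid_color; split.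
- move=> x y _; rewrite /grid_color.
  by case: ifP => _; [|case: ifP => _]; rewrite ?vcolor_lt ?hcolor_lt.
- exact: grid_color_sym.
- move=> x y z xy yz xz; rewrite grid_color_sym //.
  by apply: grid_color_center; rewrite // adj_sym.
move=> x y z t u /and5P[xy yz zt tu _].
move=> /= /and3P[+ + _] /and3P[_ + _]; rewrite !inE !negb_or.
move=> /and3P[_ xz _] /andP[_ yt] /andP[_ zu].
(* The first two edges are reversed so that both halves of the walk leave the midpoint [z]. *)
rewrite grid_color_sym // [grid_color y z]grid_color_sym //.
by apply: grid_color_walk4; rewrite // 1?adj_sym // eq_sym.
Qed.

End UpperBound.

Theorem theorem21 (k n : nat) (hk : 2 <= k) (hn : 3 <= n) :
  star_chromatic_index (cart_prod (cycle_graph (2 * k)) (path_graph n)) = 6.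
Proof.
have -> : 2 * k = (2 * k - 4).+4 by lia.
have -> : n = (n - 3).+3 by lia.
apply: star_chromatic_index_eq; last exact: cycle_path_not_5_colorable.
by apply: cycle_path_6_colorable; lia.
Qed.
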